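(* Consider an admixture model with $K$ topics and topics $j,k\in\{1,\dots,K\}$. For $\lambda\in[0,1]$ let $\boldsymbol\theta_\lambda=(1-\lambda)\mathbf e_j+\lambda\mathbf e_k$, $q_\lambda=(1-\lambda)q_j+\lambda q_k$ and $s_\lambda=(1-\lambda)s_j+\lambda s_k$, and suppose $q_\lambda\in(0,1)$ for all $\lambda\in[0,1]$. Then $$\Phi(\boldsymbol\theta_\lambda)-c=\frac{a(1-q_\lambda)^2+b\,s_\lambda q_\lambda}{q_\lambda(1-q_\lambda)},$$ a ratio of polynomials of degree at most two in $\lambda$. In particular, $\Phi(\boldsymbol\theta_\lambda)$ is in general neither affine nor linear-fractional in $\lambda$ (there are such models and topics $j,k$ for which $\lambda\mapsto\Phi(\boldsymbol\theta_\lambda)$ on $[0,1]$ is neither), and $\Phi(\boldsymbol\theta_\lambda)$ need not equal $(1-\lambda)\Phi(\mathbf e_j)+\lambda\Phi(\mathbf e_k)$ (there are such models, topics $j,k$ and $\lambda\in[0,1]$ for which equality fails).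
   Context: $\mathcal V$ is a finite word vocabulary, $\dashv$ is a sentence-boundary token, $\widetilde{\mathcal V}=\mathcal V\cup\{\dashv\}$, and $\mathrm{syl}:\mathcal V\to[1,s_{\max}]$ is a bounded real-valued syllable count. An admixture model is given by probability distributions $\boldsymbol\beta_1,\dots,\boldsymbol\beta_K$ on $\widetilde{\mathcal V}$, with $\pi_{\boldsymbol\theta}=\sum_k\theta_k\boldsymbol\beta_k$ for $\boldsymbol\theta$ in the probability simplex $\Delta^{K-1}$; set $q_k=\beta_{k\dashv}$, $s_k=\sum_{w\in\mathcal V}\beta_{kw}\,\mathrm{syl}(w)$, $\mathbf q=(q_k)_k$, $\mathbf s=(s_k)_k$. For $\boldsymbol\theta\in\Delta^{K-1}$ with $0<\mathbf q^\top\boldsymbol\theta<1$, $\Phi(\boldsymbol\theta)=a\frac{1-\mathbf q^\top\boldsymbol\theta}{\mathbf q^\top\boldsymbol\theta}+b\frac{\mathbf s^\top\boldsymbol\theta}{1-\mathbf q^\top\boldsymbol\theta}+c$. $\mathbf e_j$ is the $j$-th standard basis vector. The coefficients $(a,b,c)$ are fixed: $(0.39,11.8,-15.59)$ (Flesch–Kincaid Grade Level) or $(-1.015,-84.6,206.835)$ (Flesch Reading Ease). Linear-fractional in $\lambda$ means of the form $(\alpha\lambda+\beta)/(\gamma\lambda+\delta)$ with real constants. *)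

(* Defs.v *)
From HB Require Import structures.
From mathcomp Require Import all_boot all_order all_algebra.
From mathcomp Require Import reals.

Set Implicit Arguments.
Unset Strict Implicit.
Unset Printing Implicit Defensive.

Import Order.TTheory GRing.Theory Num.Theory.
Local Open Scope ring_scope.

Record vocabulary (R : realType) := Vocabulary {
  word :> finType;
  smax : R;
  syl : word -> R;
  syl_range : forall w, 1 <= syl w <= smax
}.

(* The extended vocabulary is [option V]: [Some w] is the word [w] and [None]
   is the sentence-boundary token. *)
Record admixture (R : realType) (V : vocabulary R) (K : nat) := Admixture {
  beta : 'I_K -> option V -> R;
  beta_ge0 : forall k t, 0 <= beta k t;
  beta_sum1 : forall k, \sum_t beta k t = 1
}.

Section Readability.
Context {R : realType}.

Definition simplex (K : nat) (theta : 'cV[R]_K) : Prop :=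
  (forall i, 0 <= theta i 0) /\ \sum_i theta i 0 = 1.

Definition dot (K : nat) (u v : 'cV[R]_K) : R := (u^T *m v) 0 0.

Definition std_basis (K : nat) (j : 'I_K) : 'cV[R]_K := delta_mx j 0.

Definition qvec (V : vocabulary R) (K : nat) (M : admixture V K) : 'cV[R]_K :=
  \col_k beta M k None.

Definition svec (V : vocabulary R) (K : nat) (M : admixture V K) : 'cV[R]_K :=
  \col_k \sum_(w : V) beta M k (Some w) * syl w.

(* [Phi] below is a total function; it is meaningful on [Phi_dom] only. *)
Definition Phi_dom (V : vocabulary R) (K : nat) (M : admixture V K)
    (theta : 'cV[R]_K) : Prop :=
  simplex theta /\ 0 < dot (qvec M) theta < 1.

Definition Phi (a b c : R) (V : vocabulary R) (K : nat) (M : admixture V K)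
    (theta : 'cV[R]_K) : R :=
  a * ((1 - dot (qvec M) theta) / dot (qvec M) theta)
  + b * (dot (svec M) theta / (1 - dot (qvec M) theta)) + c.

Definition theta_seg (K : nat) (j k : 'I_K) (lam : R) : 'cV[R]_K :=
  (1 - lam) *: std_basis j + lam *: std_basis k.

Definition q_seg (V : vocabulary R) (K : nat) (M : admixture V K)
    (j k : 'I_K) (lam : R) : R :=
  (1 - lam) * qvec M j 0 + lam * qvec M k 0.

Definition s_seg (V : vocabulary R) (K : nat) (M : admixture V K)
    (j k : 'I_K) (lam : R) : R :=
  (1 - lam) * svec M j 0 + lam * svec M k 0.

Definition interior_seg (V : vocabulary R) (K : nat) (M : admixture V K)
    (j k : 'I_K) : Prop :=
  forall lam : R, 0 <= lam <= 1 -> 0 < q_seg M j k lam < 1.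

Definition affine01 (f : R -> R) : Prop :=
  exists al be : R, forall lam, 0 <= lam <= 1 -> f lam = al * lam + be.

(* The denominator must be nonzero on all of [0, 1]: division by zero is total
   here and would otherwise enlarge the class. *)
Definition linear_fractional01 (f : R -> R) : Prop :=
  exists al be ga de : R, forall lam, 0 <= lam <= 1 ->
    ga * lam + de != 0 /\ f lam = (al * lam + be) / (ga * lam + de).

End Readability.

(* Coefficients (a, b, c) of the Flesch-Kincaid Grade Level and of the Flesch
   Reading Ease. *)
Definition FKGL (R : realType) : R * R * R :=
  (39 / 100, 118 / 10, - (1559 / 100)).

Definition FRE (R : realType) : R * R * R :=
  (- (1015 / 1000), - (846 / 10), 206 + 835 / 1000).

(* Main.v *)
(* Nonlinearity is witnessed by two topics on two words with 1 and 2 syllables,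
   chosen so that s stays constant along the segment while
   q_lam = (1 + lam) / 3.  Then
   Phi - c = a (2 - lam) / (1 + lam) + 2 b / (2 - lam), which has two distinct
   simple poles, -1 and 2, whereas a linear-fractional function has at most
   one. *)
Require Import Defs.
From HB Require Import structures.
From mathcomp Require Import all_boot all_order all_algebra.
From mathcomp Require Import reals.
From mathcomp Require Import ring lra.

Set Implicit Arguments.
Unset Strict Implicit.
Unset Printing Implicit Defensive.

Import Order.TTheory GRing.Theory Num.Theory.
Local Open Scope ring_scope.

Lemma big_option (R : nmodType) (T : finType) (F : option T -> R) :
  \sum_t F t = F None + \sum_x F (Some x).
Proof.
rewrite (bigD1 None) //=; congr (_ + _).
(* The indices other than [None] are the image of [Some], whose partial inverse is [id] on
   [option T]. *)
rewrite (reindex_omap Some id) /=; last by case.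
by apply: eq_bigl => x; rewrite eqxx.
Qed.

Section Segment.
Context {R : realType}.
Implicit Types (V : vocabulary R) (K : nat).

Lemma dot_std_basis K (u : 'cV[R]_K) (j : 'I_K) : dot u (std_basis j) = u j 0.
Proof. by rewrite /dot /std_basis -colE !mxE. Qed.

(** Linearity in the second argument. For [u] equal to [qvec M] or [svec M] the right-hand side is
    [q_seg] or [s_seg] by definition. *)
Lemma dot_theta_seg K (u : 'cV[R]_K) (j k : 'I_K) (lam : R) :
  dot u (theta_seg j k lam) = (1 - lam) * u j 0 + lam * u k 0.
Proof.
rewrite -!(dot_std_basis u) /dot /theta_seg mulmxDr -!scalemxAr.
by rewrite mxE [X in X + _]mxE [X in _ + X]mxE.
Qed.

Lemma simplex_theta_seg K (j k : 'I_K) (lam : R) :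
  0 <= lam <= 1 -> simplex (theta_seg j k lam).
Proof.
move=> /andP[lam0 lam1]; split=> [i|].
  by rewrite !mxE addr_ge0 // mulr_ge0 ?subr_ge0 ?ler0n.
have sum_delta (l : 'I_K) : \sum_i std_basis l i 0 = 1 :> R.
  rewrite (bigD1 l) //= big1 => [|i /negPf il].
    by rewrite !mxE !eqxx addr0.
  by rewrite !mxE il.
transitivity ((1 - lam) * (\sum_i std_basis j i 0)
              + lam * \sum_i std_basis k i 0).
  by rewrite !mulr_sumr -big_split; apply: eq_bigr => i _; rewrite !mxE.
by rewrite !sum_delta !mulr1 subrK.
Qed.

Lemma Phi_theta_seg (a b c : R) V K (M : admixture V K) (j k : 'I_K) (lam : R) :
  Phi a b c M (theta_seg j k lam) =
    a * ((1 - q_seg M j k lam) / q_seg M j k lam)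
    + b * (s_seg M j k lam / (1 - q_seg M j k lam)) + c.
Proof. by rewrite /Phi !dot_theta_seg. Qed.

(** Affine interpolation as a formal polynomial, so that degree claims become bounds on [size],
    which is the degree plus one. *)
Definition seg_poly (x y : R) : {poly R} := (y - x) *: 'X + x%:P.

Lemma size_seg_poly (x y : R) : (size (seg_poly x y) <= 2)%N.
Proof.
rewrite (leq_trans (size_polyD _ _)) // geq_max.
by rewrite (leq_trans (size_scale_leq _ _)) ?size_polyX
  ?(leq_trans (size_polyC_leq1 _)).
Qed.

Lemma horner_seg_poly (x y lam : R) :
  (seg_poly x y).[lam] = (1 - lam) * x + lam * y.
Proof. by rewrite /seg_poly !hornerE; ring. Qed.

Lemma size_mul_leq3 (p q : {poly R}) :
  (size p <= 2)%N -> (size q <= 2)%N -> (size (p * q)%R <= 3)%N.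
Proof.
move=> p2 q2; rewrite (leq_trans (size_polyMleq _ _)) //.
by rewrite -subn1 leq_subLR (leq_add p2 q2).
Qed.

(** Taking the constant denominator 1 suffices; it remains to refute only the linear-fractional
    form. *)
Lemma affine01_linear_fractional01 (f : R -> R) :
  affine01 f -> linear_fractional01 f.
Proof.
move=> [al [be fE]]; exists al, be, 0, 1 => lam /fE ->.
by rewrite mul0r add0r oner_neq0 divr1.
Qed.

(* Clearing denominators gives a cubic identity; it holds at four points, hence
   also at the poles -1 and 2, where it forces de = ga and de = - 2 ga. *)
Lemma two_poles_not_linear_fractional01 (a b c : R) :
  a != 0 -> b != 0 ->
  ~ linear_fractional01
      (fun lam => a * ((2 - lam) / (1 + lam)) + b * (2 / (2 - lam)) + c).
Proof.
move=> a0 b0 [al [be [ga [de fE]]]].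
pose F x := (ga * x + de) *
    (a * (2 - x) ^+ 2 + b * 2 * (1 + x) + c * (1 + x) * (2 - x))
  - (al * x + be) * (1 + x) * (2 - x).
have F0 x : 0 <= x <= 1 -> F x = 0.
  move=> x01; have [den0 fx] := fE x x01.
  have x1 : 1 + x != 0 by apply: lt0r_neq0; lra.
  have x2 : 2 - x != 0 by apply: lt0r_neq0; lra.
  have -> : F x = (ga * x + de) * (1 + x) * (2 - x) *
    ((a * ((2 - x) / (1 + x)) + b * (2 / (2 - x)) + c)
     - (al * x + be) / (ga * x + de)).
    by rewrite /F; field; rewrite den0 x1 x2.
  by rewrite fx subrr mulr0.
have f0 : F 0 = 0 by apply: F0; lra.
have f1 : F (1 / 3) = 0 by apply: F0; lra.
have f2 : F (2 / 3) = 0 by apply: F0; lra.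
have f3 : F 1 = 0 by apply: F0; lra.
(* The coefficients here and for [F 2] are the Lagrange weights that extrapolate a cubic from the
   nodes 0, 1/3, 2/3, 1. *)
have Fm1 : F (- 1) = 0.
  have -> : F (- 1) = 20 * F 0 - 45 * F (1 / 3) + 36 * F (2 / 3) - 10 * F 1.
    by rewrite /F; field.
  by rewrite f0 f1 f2 f3; ring.
have F2 : F 2 = 0.
  have -> : F 2 = - 10 * F 0 + 36 * F (1 / 3) - 45 * F (2 / 3) + 20 * F 1.
    by rewrite /F; field.
  by rewrite f0 f1 f2 f3; ring.
(* At -1 the factor [1 + x] leaves only [9 * a * (de - ga)]; at 2 the factor [2 - x] leaves only
   [6 * b * (de + 2 * ga)]. *)
have e1 : de - ga = 0.
  apply: (mulfI a0); rewrite mulr0.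
  have -> : a * (de - ga) = F (- 1) / 9 by rewrite /F; field.
  by rewrite Fm1 mul0r.
have e2 : de + 2 * ga = 0.
  apply: (mulfI b0); rewrite mulr0.
  have -> : b * (de + 2 * ga) = F 2 / 6 by rewrite /F; field.
  by rewrite F2 mul0r.
(* Now [ga = de = 0], so the denominator vanishes at 0, which [linear_fractional01] excludes. *)
have [] := fE 0; first by lra.
by rewrite mulr0 add0r => /eqP; lra.
Qed.

Definition witness_syl (w : bool) : R := if w then 2 else 1.

Lemma witness_syl_range w : 1 <= witness_syl w <= 2.
Proof. by case: w; rewrite /witness_syl; lra. Qed.

Definition witness_vocabulary : vocabulary R := Vocabulary witness_syl_range.

(** Topic 0 puts mass 2/3 on the one-syllable word and topic 1 puts 1/3 on the two-syllable word, so
    both have s = 2/3, while q is 1/3 and 2/3. *)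
Definition witness_beta (k : 'I_2) (t : option bool) : R :=
  match t with
  | None => if k == 0 then 1 / 3 else 2 / 3
  | Some false => if k == 0 then 2 / 3 else 0
  | Some true => if k == 0 then 0 else 1 / 3
  end.

Lemma witness_beta_ge0 k t : 0 <= witness_beta k t.
Proof. by case: t => [[]|] /=; case: ifP => _; lra. Qed.

Lemma witness_beta_sum1 k : \sum_t witness_beta k t = 1.
Proof. by rewrite big_option big_bool /=; case: ifP => _; lra. Qed.

Definition witness_admixture : admixture witness_vocabulary 2 :=
  @Admixture R witness_vocabulary 2 witness_beta witness_beta_ge0 witness_beta_sum1.

Lemma q_seg_witness (lam : R) : q_seg witness_admixture 0 1 lam = (1 + lam) / 3.
Proof. by rewrite /q_seg !mxE /=; field. Qed.

Lemma s_seg_witness (lam : R) : s_seg witness_admixture 0 1 lam = 2 / 3.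
Proof. by rewrite /s_seg !mxE !big_bool /= /witness_syl; field. Qed.

Lemma interior_seg_witness : interior_seg witness_admixture 0 1.
Proof. by move=> lam lam01; rewrite q_seg_witness; lra. Qed.

Lemma Phi_witness (a b c lam : R) : 0 <= lam <= 1 ->
  Phi a b c witness_admixture (theta_seg 0 1 lam) =
    a * ((2 - lam) / (1 + lam)) + b * (2 / (2 - lam)) + c.
Proof.
move=> lam01; rewrite Phi_theta_seg q_seg_witness s_seg_witness; field.
by apply/andP; split; apply: lt0r_neq0; lra.
Qed.

End Segment.

Theorem proposition8 (R : realType) (a b c : R)
    (habc : (a, b, c) = FKGL R \/ (a, b, c) = FRE R) :
  (forall (V : vocabulary R) (K : nat) (M : admixture V K) (j k : 'I_K),
     interior_seg M j k ->
     (forall lam : R, 0 <= lam <= 1 ->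
        Phi_dom M (theta_seg j k lam) /\
        Phi a b c M (theta_seg j k lam) - c =
          (a * (1 - q_seg M j k lam) ^+ 2
             + b * s_seg M j k lam * q_seg M j k lam)
          / (q_seg M j k lam * (1 - q_seg M j k lam))) /\
     (exists P Q : {poly R},
        (size P <= 3)%N /\ (size Q <= 3)%N /\
        forall lam : R, 0 <= lam <= 1 ->
          a * (1 - q_seg M j k lam) ^+ 2
            + b * s_seg M j k lam * q_seg M j k lam = P.[lam] /\
          q_seg M j k lam * (1 - q_seg M j k lam) = Q.[lam])) /\
  (exists (V : vocabulary R) (K : nat) (M : admixture V K) (j k : 'I_K),
     interior_seg M j k /\
     ~ affine01 (fun lam => Phi a b c M (theta_seg j k lam)) /\
     ~ linear_fractional01 (fun lam => Phi a b c M (theta_seg j k lam))) /\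
  (exists (V : vocabulary R) (K : nat) (M : admixture V K) (j k : 'I_K)
          (lam : R),
     interior_seg M j k /\ 0 <= lam <= 1 /\
     Phi a b c M (theta_seg j k lam) <>
       (1 - lam) * Phi a b c M (std_basis j)
       + lam * Phi a b c M (std_basis k)).
Proof.
(* [3 * a + 2 * b] is twelve times the gap at the midpoint between the chord and [Phi] on the
   witness segment. *)
have [a0 b0 ab0] : [/\ a != 0, b != 0 & 3 * a + 2 * b != 0].
  by case: habc => -[-> -> _]; split; apply/eqP; lra.
split=> [V K M j k int_jk|]; last split.
- split=> [lam lam01|].
    have /andP[q0 q1] := int_jk lam lam01; split.
      split; first exact: simplex_theta_seg.
      by rewrite dot_theta_seg; apply/andP.
    rewrite Phi_theta_seg; field.
    by rewrite !lt0r_neq0 // subr_gt0.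
  pose q := seg_poly (qvec M j 0) (qvec M k 0).
  pose s := seg_poly (svec M j 0) (svec M k 0).
  (* The weights sum to 1, so [1 - q_seg] interpolates the endpoint values of 1 - q; every term is
     then a product of two affine polynomials. *)
  pose q' := seg_poly (1 - qvec M j 0) (1 - qvec M k 0).
  exists (a *: (q' * q') + b *: (s * q)), (q * q'); split; last split.
  + rewrite (leq_trans (size_polyD _ _)) // geq_max.
    by rewrite !(leq_trans (size_scale_leq _ _)) ?size_mul_leq3 ?size_seg_poly.
  + by rewrite size_mul_leq3 ?size_seg_poly.
  + move=> lam _; rewrite hornerD !hornerZ !hornerM !horner_seg_poly.
    rewrite /q_seg /s_seg.
    by split; ring.
- exists witness_vocabulary, 2, witness_admixture, 0, 1.
  have not_lf : ~ linear_fractional01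
      (fun lam => Phi a b c witness_admixture (theta_seg 0 1 lam)).
    move=> [al [be [ga [de fE]]]].
    apply: (two_poles_not_linear_fractional01 (c := c) a0 b0).
    by exists al, be, ga, de => lam lam01; rewrite -Phi_witness //; exact: fE.
  split; first exact: interior_seg_witness.
  by split=> // /affine01_linear_fractional01.
- exists witness_vocabulary, 2, witness_admixture, 0, 1, (1 / 2).
  split; first exact: interior_seg_witness.
  split; first by lra.
  (* The vertices are rewritten as the segment points at 0 and 1, so that [Phi_witness] evaluates
     all three values of [Phi]. *)
  have <- : theta_seg 0 1 0 = std_basis 0 :> 'cV[R]_2.
    by rewrite /theta_seg subr0 scale1r scale0r addr0.
  have <- : theta_seg 0 1 1 = std_basis 1 :> 'cV[R]_2.
    by rewrite /theta_seg subrr scale1r scale0r add0r.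
  rewrite !Phi_witness; try lra.
  move=> eq_mid; move/eqP: ab0; apply.
  have <- : 12 *
    ((1 - 1 / 2) * (a * ((2 - 0) / (1 + 0)) + b * (2 / (2 - 0)) + c)
      + 1 / 2 * (a * ((2 - 1) / (1 + 1)) + b * (2 / (2 - 1)) + c)
      - (a * ((2 - 1 / 2) / (1 + 1 / 2)) + b * (2 / (2 - 1 / 2)) + c))
      = 3 * a + 2 * b by field.
  by rewrite -eq_mid subrr mulr0.
Qed.
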